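(* Let $\lambda_1\ge\cdots\ge\lambda_k>0$, and let $\widehat\lambda_1,\dots,\widehat\lambda_k$ satisfy $\lambda_1\ge\widehat\lambda_1\ge\widehat\lambda_2\ge\cdots\ge\widehat\lambda_k>0$. Let $\zeta_i=\left|\frac{\widehat\lambda_i-\lambda_i}{\lambda_i}\right|$, let $\tau_i=\|\widehat v_i-v_i\|$ be the perturbation magnitudes of the unit eigenvectors, and $w_i=2\tau_i+\tau_i^2$, $i=1,\dots,k$. Then the perturbation bound $$f(\theta)=C(\theta)\sum_{i=1}^k\left(\frac{\theta\zeta_i}{\widehat\lambda_i}+w_i\left|1-\frac{\theta}{\widehat\lambda_i}\right|\right),\qquad C(\theta)=\begin{cases}1,&\theta\ge\lambda_1,\\[1ex]\dfrac{\lambda_1}{\theta},&0<\theta<\lambda_1,\end{cases}$$ is minimized over $\theta>0$ by taking $\theta^\star$ to be a weighted median of the perturbed dominant eigenvalues $\{\widehat\lambda_1,\dots,\widehat\lambda_k\}$ with weights $w_1,\dots,w_k$. Equivalently, one such minimizer is $\theta^\star=\widehat\lambda_j$, where $j$ is the smallest index satisfying $$\sum_{i=1}^{j-1}w_i\le\frac W2\le\sum_{i=1}^jw_i,\qquad W=\sum_{i=1}^kw_i.$$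
   Context: Setting: $(\lambda_i,v_i)$, $i=1,\dots,k$, are the $k$ dominant eigenpairs (orthonormal $v_i$) of a symmetric positive definite matrix $A\in\mathbb{R}^{n\times n}$; $(\widehat\lambda_i,\widehat v_i)$ are perturbed eigenpairs with $\|\widehat v_i\|=1$ (Euclidean norm). The function $f(\theta)$ is the paper's upper bound on the relative perturbation $\|(\widehat H_k-H_k)y\|/\|H_ky\|$, where $H_k=I-\sum_{i=1}^k(1-\theta/\lambda_i)v_iv_i^T$ and $\widehat H_k=I-\sum_{i=1}^k(1-\theta/\widehat\lambda_i)\widehat v_i\widehat v_i^T$; $\theta>0$ is the cluster point. A weighted median of real numbers $x_1,\dots,x_k$ with weights $w_1,\dots,w_k\ge0$, $W=\sum_iw_i$, is a number $m\in[\min_ix_i,\max_ix_i]$ such that $\sum_{i:\,x_i<m}w_i\le W/2$ and $\sum_{i:\,x_i>m}w_i\le W/2$. *)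

(* Defs.v *)
From mathcomp Require Import all_boot all_order all_algebra reals.

Set Implicit Arguments.
Unset Strict Implicit.
Unset Printing Implicit Defensive.

Import Order.TTheory GRing.Theory Num.Theory.
Local Open Scope ring_scope.

Definition dotv (R : realType) (n : nat) (u v : 'cV[R]_n) : R :=
  (u^T *m v) 0 0.

(* The norm that MathComp-Analysis puts on matrices is the sup norm, hence
   this explicit Euclidean norm. *)
Definition norm2 (R : realType) (n : nat) (u : 'cV[R]_n) : R :=
  Num.sqrt (dotv u u).

Definition spd (R : realType) (n : nat) (A : 'M[R]_n) : Prop :=
  A \is symmetricmx /\ forall u : 'cV[R]_n, u != 0 -> 0 < dotv u (A *m u).

(* The last clause says that these are the largest eigenvalues, counted with
   multiplicity: an eigenvalue with an eigenvector orthogonal to all the v i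
   is one of the remaining ones. *)
Definition dominant_eigenpairs (R : realType) (n k : nat) (A : 'M[R]_n)
    (lam : 'I_k -> R) (v : 'I_k -> 'cV[R]_n) : Prop :=
  [/\ forall i, A *m v i = lam i *: v i,
      forall i j, dotv (v i) (v j) = (i == j)%:R &
      forall (mu : R) (u : 'cV[R]_n), u != 0 -> A *m u = mu *: u ->
        (forall i, dotv (v i) u = 0) -> forall i, mu <= lam i].

(* Families indexed from 1 to k, with k >= 1, are functions on 'I_k.+1: the
   number of eigenpairs is k.+1 and the first index is ord0. *)

Definition C_factor (R : realType) (lam1 theta : R) : R :=
  if lam1 <= theta then 1 else lam1 / theta.

Definition perturbation_bound (R : realType) (k : nat)
    (lam lamh zeta w : 'I_k.+1 -> R) (theta : R) : R :=
  C_factor (lam ord0) theta *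
  \sum_(i < k.+1)
     (theta * zeta i / lamh i + w i * `|1 - theta / lamh i|).

Definition minimizer_on_pos (R : realType) (f : R -> R) (t : R) : Prop :=
  0 < t /\ forall theta : R, 0 < theta -> f t <= f theta.

Definition weighted_median (R : realType) (k : nat) (x w : 'I_k.+1 -> R)
    (m : R) : Prop :=
  let W := \sum_(i < k.+1) w i in
  [/\ \big[Num.min/x ord0]_(i < k.+1) x i <= m
        <= \big[Num.max/x ord0]_(i < k.+1) x i,
      \sum_(i < k.+1 | x i < m) w i <= W / 2 &
      \sum_(i < k.+1 | m < x i) w i <= W / 2].

Definition half_weight_index (R : realType) (k : nat) (w : 'I_k.+1 -> R)
    (j : 'I_k.+1) : Prop :=
  let W := \sum_(i < k.+1) w i in
  \sum_(i < k.+1 | (i < j)%N) w i <= W / 2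
    <= \sum_(i < k.+1 | (i <= j)%N) w i.

Definition first_half_weight_index (R : realType) (k : nat)
    (w : 'I_k.+1 -> R) (j : 'I_k.+1) : Prop :=
  half_weight_index w j /\
  forall j' : 'I_k.+1, half_weight_index w j' -> (j <= j')%N.

(* Main.v *)
Require Import Defs.
From mathcomp Require Import all_boot all_order all_algebra reals.
From mathcomp Require Import ring lra.

(** In terms of the reciprocal [s = 1 / theta], the bound is a weighted
    least-absolute-deviations objective. Indeed, for [theta <= lambda_1] the
    factor [lambda_1 / theta] turns it into
      lambda_1 * (sum_i zeta_i / lamh_i + sum_i w_i * |s - 1 / lamh_i|)
    ([perturbation_bound_reciprocal]), whose first sum does not depend on
    [theta]. The second sum, as a function of [s], is minimized by the weighted
    medians of the [1 / lamh_i] ([weighted_median_minimizes]). The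
    condition defining weighted medians only compares the weights on the two
    sides of a point, so the order-reversing map [x |-> 1 / x] carries weighted
    medians of the [lamh_i] to weighted medians of the [1 / lamh_i].

    For [theta >= lambda_1] every [lamh_i] is at most [theta], so each absolute
    value opens as [theta / lamh_i - 1] and the bound is nondecreasing in
    [theta] ([perturbation_bound_lam1_le]); nothing better than [theta = lambda_1] is
    found there, and that point belongs to the first regime. A weighted median
    lies between the extreme [lamh_i], hence in the first regime as well.

    For the index form, the first [j] whose partial sum of weights reaches
    [W / 2] has all earlier partial sums below [W / 2]; since the [lamh_i]
    decrease, the indices with [lamh_i > lamh_j] come before [j] and those with
    [lamh_i < lamh_j] after it, so both sides of [lamh_j] carry at most half of
    the weight. *)

Set Implicit Arguments.
Unset Strict Implicit.
Unset Printing Implicit Defensive.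

Import Order.TTheory GRing.Theory Num.Theory.
Local Open Scope ring_scope.

(** Moving right from [m] to [s] costs [s - m] per unit of weight at points
    [x i <= m] and gains at most [s - m] per unit of weight at points beyond
    [m]; the former weight is at least half of the total. *)
Lemma weighted_deviation_le_right (R : realFieldType) (I : finType)
    (x w : I -> R) (m s : R) :
  (forall i, 0 <= w i) -> m <= s ->
  \sum_(i | m < x i) w i <= (\sum_i w i) / 2 ->
  \sum_i w i * `|m - x i| <= \sum_i w i * `|s - x i|.
Proof.
move=> w_ge0 le_ms right_le.
have term i :
    w i * `|m - x i| + (s - m) * (w i - 2 * (if m < x i then w i else 0))
      <= w i * `|s - x i|.
  case: ifP => [lt_mx|/negbT]; last rewrite -leNgt => le_xm.
    have -> : w i * `|m - x i| + (s - m) * (w i - 2 * w i) = w i * (x i - s).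
      by rewrite ltr0_norm ?subr_lt0 //; ring.
    by rewrite ler_wpM2l // -normrN opprB ler_norm.
  have -> : w i * `|m - x i| + (s - m) * (w i - 2 * 0) = w i * (s - x i).
    by rewrite ger0_norm ?subr_ge0 //; ring.
  by rewrite ler_wpM2l // ler_norm.
apply: le_trans (ler_sum _ (fun i _ => term i)).
rewrite big_split /= -mulr_sumr sumrB -mulr_sumr -big_mkcond /=.
rewrite lerDl mulr_ge0 ?subr_ge0 //.
by rewrite mulrC -ler_pdivlMr.
Qed.

Lemma weighted_median_minimizes (R : realFieldType) (I : finType)
    (x w : I -> R) (m s : R) :
  (forall i, 0 <= w i) ->
  \sum_(i | x i < m) w i <= (\sum_i w i) / 2 ->
  \sum_(i | m < x i) w i <= (\sum_i w i) / 2 ->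
  \sum_i w i * `|m - x i| <= \sum_i w i * `|s - x i|.
Proof.
move=> w_ge0 left_le right_le.
have [le_ms|/ltW le_sm] := leP m s; first exact: weighted_deviation_le_right.
(* A move to the left is a move to the right of the reflected points. *)
have reflect t : \sum_i w i * `|t - x i| = \sum_i w i * `|- t - - x i|.
  by apply: eq_bigr => i _; rewrite -opprD normrN.
rewrite !reflect; apply: weighted_deviation_le_right; rewrite ?lerN2 //.
by under eq_bigl => i do rewrite ltrN2.
Qed.

Lemma weighted_median_bounds (R : realType) (k : nat) (x w : 'I_k.+1 -> R)
    (a b m : R) :
  (forall i, a < x i) -> (forall i, x i <= b) -> weighted_median x w m ->
  a < m <= b.
Proof.
move=> a_lt le_b [/andP[min_le le_max] _ _]; apply/andP; split.
  by apply: lt_le_trans min_le; apply: lt_bigmin.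
by apply: le_trans le_max _; apply: bigmax_le.
Qed.

(** Since [lam1 <= theta] selects the factor [1], the case [theta = lam ord0]
    is covered because [lam1 / theta = 1] there. *)
Lemma perturbation_bound_reciprocal (R : realType) (k : nat)
    (lam lamh zeta w : 'I_k.+1 -> R) (theta : R) :
  0 < theta <= lam ord0 ->
  perturbation_bound lam lamh zeta w theta =
    lam ord0 * (\sum_i zeta i / lamh i
                + \sum_i w i * `|theta^-1 - (lamh i)^-1|).
Proof.
move=> /andP[theta_gt0 theta_le].
have -> : perturbation_bound lam lamh zeta w theta =
    lam ord0 / theta *
      \sum_i (theta * zeta i / lamh i + w i * `|1 - theta / lamh i|).
  rewrite /perturbation_bound /C_factor; case: ifP => // lam_le.
  have -> : theta = lam ord0 by apply/le_anti/andP.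
  by rewrite divff // gt_eqF // (lt_le_trans theta_gt0).
rewrite -mulrA -big_split mulr_sumr /=; congr (_ * _); apply: eq_bigr => i _.
have -> : 1 - theta / lamh i = theta * (theta^-1 - (lamh i)^-1).
  by rewrite mulrBr divff ?gt_eqF.
rewrite normrM (gtr0_norm theta_gt0) mulrDr; congr (_ + _).
  by rewrite -mulrA mulKf ?gt_eqF.
by rewrite mulrCA mulKf ?gt_eqF.
Qed.

Lemma perturbation_bound_lam1_le (R : realType) (k : nat)
    (lam lamh zeta w : 'I_k.+1 -> R) (theta : R) :
  (forall i, 0 < lamh i) -> (forall i, lamh i <= lam ord0) ->
  (forall i, 0 <= zeta i) -> (forall i, 0 <= w i) -> lam ord0 <= theta ->
  perturbation_bound lam lamh zeta w (lam ord0)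
    <= perturbation_bound lam lamh zeta w theta.
Proof.
move=> lamh_gt0 lamh_le zeta_ge0 w_ge0 le_theta.
rewrite /perturbation_bound /C_factor lexx le_theta !mul1r.
apply: ler_sum => i _; apply: lerD.
  by rewrite !ler_wpM2r // invr_ge0 ltW.
have ratio_ge1 t : lam ord0 <= t -> 1 <= t / lamh i.
  by move=> le_t; rewrite ler_pdivlMr // mul1r (le_trans (lamh_le i)).
rewrite ler_wpM2l // !ler0_norm ?subr_le0 ?ratio_ge1 // lerN2 lerB //.
by rewrite ler_wpM2r // invr_ge0 ltW.
Qed.

Lemma weighted_median_minimizes_bound (R : realType) (k : nat)
    (lam lamh zeta w : 'I_k.+1 -> R) (m : R) :
  (forall i, 0 < lamh i) -> (forall i, lamh i <= lam ord0) ->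
  (forall i, 0 <= zeta i) -> (forall i, 0 <= w i) ->
  weighted_median lamh w m ->
  minimizer_on_pos (perturbation_bound lam lamh zeta w) m.
Proof.
move=> lamh_gt0 lamh_le zeta_ge0 w_ge0 med_m.
have m_bounds := weighted_median_bounds lamh_gt0 lamh_le med_m.
have /andP[m_gt0 m_le] := m_bounds; split=> // theta theta_gt0.
have lam1_gt0 := lt_le_trans m_gt0 m_le.
have small t : 0 < t <= lam ord0 ->
    perturbation_bound lam lamh zeta w m
      <= perturbation_bound lam lamh zeta w t.
  move=> t_bounds; rewrite !perturbation_bound_reciprocal //.
  rewrite ler_wpM2l ?(ltW lam1_gt0) // lerD2l.
  (* Reciprocals swap the two half-weight conditions on [m]. *)
  case: med_m => _ left_le right_le; apply: weighted_median_minimizes => //.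
    by under eq_bigl => i do rewrite ltf_pV2 ?posrE //.
  by under eq_bigl => i do rewrite ltf_pV2 ?posrE //.
have [theta_le|/ltW le_theta] := leP theta (lam ord0).
  by apply: small; rewrite theta_gt0.
apply: le_trans (perturbation_bound_lam1_le _ _ _ _ le_theta) => //.
by apply: small; rewrite lam1_gt0 lexx.
Qed.

(** The index sought is the first one whose inclusive partial sum reaches half
    of the weight: either it is the first index, with an empty strict partial
    sum, or its predecessor has not reached half of the weight. *)
Lemma exists_first_half_weight_index (R : realType) (k : nat)
    (w : 'I_k.+1 -> R) :
  (forall i, 0 <= w i) -> exists j, first_half_weight_index w j.
Proof.
move=> w_ge0; set W := \sum_i w i.
have W_ge0 : 0 <= W by apply: sumr_ge0.
pose reaches (j : 'I_k.+1) := W / 2 <= \sum_(i < k.+1 | (i <= j)%N) w i.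
have reaches_max : reaches ord_max.
  rewrite /reaches (eq_bigl xpredT) => [|i]; last by rewrite -ltnS ltn_ord.
  by rewrite -/W; lra.
case: (@arg_minnP _ ord_max reaches val reaches_max) => j reaches_j min_j.
exists j; split; last by move=> j' /andP[_ /min_j].
apply/andP; split=> //; rewrite -/W.
case: (posnP j) => [j0|j_gt0].
  by rewrite big1 => [|i]; [lra | rewrite j0].
have lt_pj : (j.-1 < k.+1)%N by apply: leq_ltn_trans (leq_pred j) (ltn_ord j).
have : ~~ reaches (Ordinal lt_pj).
  by apply/negP => /min_j /=; rewrite leqNgt ltn_predL j_gt0.
rewrite /reaches -ltNge => /ltW; apply: le_trans; rewrite le_eqVlt.
by under eq_bigl => i do rewrite -(prednK j_gt0) ltnS; rewrite eqxx.
Qed.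

Lemma half_weight_index_median (R : realType) (k : nat)
    (x w : 'I_k.+1 -> R) (j : 'I_k.+1) :
  (forall i j : 'I_k.+1, (i <= j)%N -> x j <= x i) -> (forall i, 0 <= w i) ->
  half_weight_index w j -> weighted_median x w (x j).
Proof.
move=> x_decr w_ge0 /andP[before_le le_upto]; split.
- by rewrite bigmin_le_cond //= le_bigmax_cond.
- (* The points below [x j] have indices after [j]. *)
  have : \sum_(i | x i < x j) w i <= \sum_(i < k.+1 | ~~ (i <= j)%N) w i.
    rewrite [leLHS]big_mkcond [leRHS]big_mkcond; apply: ler_sum => i _ /=.
    case: ifP => [lt_x|_]; last by case: ifP.
    by case: leqP => // /x_decr; rewrite leNgt lt_x.
  move: le_upto.
  rewrite (bigID (fun i : 'I_k.+1 => (i <= j)%N) xpredT) /=; lra.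
- apply: le_trans before_le.
  rewrite [leLHS]big_mkcond [leRHS]big_mkcond; apply: ler_sum => i _ /=.
  case: ifP => [lt_x|_]; last by case: ifP.
  by case: ltnP => // /x_decr; rewrite leNgt lt_x.
Qed.

Theorem theorem3p8 (R : realType) (n k : nat) (A : 'M[R]_n)
    (lam lamh : 'I_k.+1 -> R) (v vh : 'I_k.+1 -> 'cV[R]_n)
    (A_spd : spd A)
    (lam_v_dominant : dominant_eigenpairs A lam v)
    (lam_decr : forall i j : 'I_k.+1, (i <= j)%N -> lam j <= lam i)
    (lam_gt0 : forall i : 'I_k.+1, 0 < lam i)
    (lamh_le : lamh ord0 <= lam ord0)
    (lamh_decr : forall i j : 'I_k.+1, (i <= j)%N -> lamh j <= lamh i)
    (lamh_gt0 : forall i : 'I_k.+1, 0 < lamh i)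
    (vh_unit : forall i : 'I_k.+1, norm2 (vh i) = 1) :
  let zeta := fun i : 'I_k.+1 => `|(lamh i - lam i) / lam i| in
  let tau := fun i : 'I_k.+1 => norm2 (vh i - v i) in
  let w := fun i : 'I_k.+1 => 2 * tau i + tau i ^+ 2 in
  let f := perturbation_bound lam lamh zeta w in
  (forall m : R, weighted_median lamh w m -> minimizer_on_pos f m) /\
  (exists j : 'I_k.+1, first_half_weight_index w j) /\
  (forall j : 'I_k.+1, first_half_weight_index w j ->
     weighted_median lamh w (lamh j) /\ minimizer_on_pos f (lamh j)).
Proof.
move=> zeta tau w f.
have zeta_ge0 i : 0 <= zeta i by apply: normr_ge0.
have tau_ge0 i : 0 <= tau i by apply: sqrtr_ge0.
have w_ge0 i : 0 <= w i by rewrite addr_ge0 ?mulr_ge0 ?exprn_ge0.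
have lamh_le_lam1 i : lamh i <= lam ord0.
  by apply: le_trans (lamh_decr _ _ _) lamh_le.
have med_min m : weighted_median lamh w m -> minimizer_on_pos f m.
  exact: weighted_median_minimizes_bound.
split=> //; split; first exact: exists_first_half_weight_index.
move=> j [half_j _].
have med_j : weighted_median lamh w (lamh j) by apply: half_weight_index_median.
by split=> //; apply: med_min.
Qed.
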